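(* For each real number $c \in (0,4)$ and each $N \in \mathbb{N}$, there exists a monic polynomial $p(z) = z^n + a_{n-1} z^{n-1} + \dots + a_0$ with complex coefficients (of some degree $n$) such that the set $\{z \in \mathbb{C} : |p(z)| \leq 1\}$ has at least $N$ connected components each of which has diameter at least $c$.
   Context: The diameter of a set $S \subset \mathbb{C}$ is $\sup\{|z-w| : z,w \in S\}$, with respect to the usual Euclidean distance on $\mathbb{C}$. *)

(* Defs.v *)
From HB Require Import structures.
From mathcomp Require Import all_boot all_order all_algebra.
From mathcomp Require Import complex.
From mathcomp Require Import all_classical all_reals all_analysis.

Set Implicit Arguments.
Unset Strict Implicit.
Unset Printing Implicit Defensive.

Import Order.TTheory GRing.Theory Num.Theory.
Import numFieldNormedType.Exports.

Local Open Scope classical_set_scope.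
Local Open Scope ring_scope.
Local Open Scope complex_scope.

(* The complex numbers over [R : realType] are [R[i]]. The norm [`|z|] of
   [R[i]] is the Euclidean modulus, but it is valued in [R[i]], as a complex
   number with zero imaginary part; [Re] brings it back to [R]. The carrier is
   written [R[i]^o] because the topology induced by this norm is only attached
   to that alias. *)

(* Valued in the extended reals, since the set may be unbounded. *)
Definition diameter (R : realType) (S : set R[i]^o) : \bar R :=
  ereal_sup [set (complex.Re `|z - w|)%:E | z in S & w in S].

Definition components (T : topologicalType) (A : set T) : set (set T) :=
  connected_component A @` A.

(* For [x, y] in [R[i]], [x <= y] means that [y - x] is real and nonnegative;
   as a modulus is real, the inequality below is the one between reals. *)
Definition lemniscate_set (R : realType) (p : {poly R[i]}) : set R[i]^o :=
  [set z | `|p.[z]| <= 1].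

(* Main.v *)
Require Import Defs.
From HB Require Import structures.
From mathcomp Require Import all_boot all_order all_algebra.
From mathcomp Require Import complex.
From mathcomp Require Import all_classical all_reals all_analysis.
From mathcomp Require Import ring lra zify.

Set Implicit Arguments.
Unset Strict Implicit.
Unset Printing Implicit Defensive.

Import Order.TTheory GRing.Theory Num.Theory.
Import numFieldNormedType.Exports.

Local Open Scope classical_set_scope.
Local Open Scope card_scope.
Local Open Scope ring_scope.
Local Open Scope complex_scope.

Import Normc.

(* Write c = 2a. Take N + 1 segments of length c on rays from the origin, at
   distances between 4 - a and 4 + a and at angles 2k pi / m, with m large:
   they are close to the real segment [4 - a, 4 + a], whose capacity is
   a / 2 < 1, so a scaled Chebyshev polynomial q has |q| < 1 on their union E.
   On the lines at angles (2k + 1) pi / m, which separate them, the polynomial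
   Q = 1 - z^m / (4 + a)^m is, near E, larger in modulus than on E. This Q has
   the wrong normalization, but let F be the monic polynomial whose roots are n
   almost extremal (Fekete) points of E. Lagrange interpolation at these points
   shows both that sup_E |F| <= 1 (interpolate a power of q) and that
   |F| > sup_E |F| on the separating lines near E (interpolate a power of Q);
   far from E, all factors of F exceed 1 in modulus. Rescaling F so that
   sup_E |F| becomes 1 only enlarges the segments; they lie in distinct
   components, as Im (z / w) vanishes only on the line through w. *)

(** * Real-valued modulus of complex numbers *)

Section Modulus.
Variable R : rcfType.
Implicit Types z w : R[i].

Lemma normc_normr z : `|z| = (normc z)%:C.
Proof. by case: z => a b; rewrite normc_def. Qed.

Lemma normc_ge0 z : 0 <= normc z.
Proof. by case: z => a b; exact: sqrtr_ge0. Qed.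

Lemma normc_gt0 z : (0 < normc z) = (z != 0).
Proof.
rewrite lt_neqAle normc_ge0 andbT eq_sym; congr (~~ _).
by apply/eqP/eqP => [/eq0_normc//|->]; rewrite normc0.
Qed.

Lemma normcR (x : R) : normc x%:C = `|x|.
Proof. by rewrite /= expr0n /= addr0 sqrtr_sqr. Qed.

Lemma normcBC z w : normc (z - w) = normc (w - z).
Proof. by rewrite -normcN opprB. Qed.

Lemma le_normcB z w : normc z - normc w <= normc (z - w).
Proof. by rewrite lerBlDr -{1}(subrK w z) le_normcD. Qed.

Lemma normcX z n : normc (z ^+ n) = normc z ^+ n.
Proof. by elim: n => [|n IH]; rewrite ?expr0 ?normc1// !exprS normcM IH. Qed.

Lemma normc_prod I (r : seq I) (P : pred I) (F : I -> R[i]) :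
  normc (\prod_(i <- r | P i) F i) = \prod_(i <- r | P i) normc (F i).
Proof. exact: (big_morph _ (@normcM R) (normc1 R)). Qed.

Lemma le_normc_sum I (r : seq I) (P : pred I) (F : I -> R[i]) :
  normc (\sum_(i <- r | P i) F i) <= \sum_(i <- r | P i) normc (F i).
Proof.
elim/big_ind2: _ => [|x a y b xa yb|//]; first by rewrite normc0.
exact: le_trans (le_normcD _ _) (lerD xa yb).
Qed.

Lemma le_Re_normc z : `|complex.Re z| <= normc z.
Proof. by rewrite -lecR -normc_normr normc_ge_Re. Qed.

(** Induction on the form [q * 'X + c]: the Lipschitz bound for [q] also bounds [q] on the disc,
    which controls the product. *)
Lemma poly_lipschitz (q : {poly R[i]}) (B : R) : exists2 l : R, 0 < l &
  forall z w, normc z <= B -> normc w <= B ->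
    normc (q.[z] - q.[w]) <= l * normc (z - w).
Proof.
elim/poly_ind: q => [|q c [l l0 IH]].
  by exists 1 => // z w _ _; rewrite !horner0 subr0 normc0 mul1r normc_ge0.
have [b b0 Hb] : exists2 b : R, 0 < b &
    forall w, normc w <= B -> normc q.[w] <= b.
  case: (leP 0 B) => [B0|B0]; last first.
    exists 1 => // w wB; have := le_lt_trans wB B0.
    by rewrite ltNge normc_ge0.
  exists (normc q.[0] + l * B + 1).
    by have := normc_ge0 q.[0]; have := mulr_ge0 (ltW l0) B0; lra.
  move=> w wB; rewrite -(subrK q.[0] q.[w]).
  apply: le_trans (le_normcD _ _) _.
  have := IH w 0 wB; rewrite normc0 subr0 => /(_ B0) H.
  have : l * normc w <= l * B by rewrite ler_pM2l.
  by lra.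
exists (l * `|B| + b); first by have := mulr_ge0 (ltW l0) (normr_ge0 B); lra.
move=> z w zB wB; rewrite !hornerMXaddC.
have -> : q.[z] * z + c - (q.[w] * w + c) = (q.[z] - q.[w]) * z + q.[w] * (z - w).
  by ring.
apply: le_trans (le_normcD _ _) _; rewrite !normcM mulrDl lerD//.
  rewrite mulrAC ler_pM ?normc_ge0 ?IH//.
  exact: le_trans zB (ler_norm _).
by rewrite ler_wpM2r ?normc_ge0 ?Hb.
Qed.

End Modulus.

(** * Lagrange interpolation *)

Section Lagrange.
Variables (F : fieldType) (n : nat) (x : 'I_n -> F).
Hypothesis x_inj : injective x.

Lemma size_prod_XsubC_neq (j : 'I_n) :
  size (\prod_(i < n | i != j) ('X - (x i)%:P)) = n.
Proof.
rewrite -big_filter size_prod_XsubC size_filter -sum1_count sum1_card cardC1.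
by rewrite card_ord prednK// (leq_ltn_trans _ (ltn_ord j)).
Qed.

(** The difference of the two sides has size at most [n] and vanishes at [n] distinct nodes. *)
Lemma lagrange_interpolation (q : {poly F}) : (size q <= n)%N ->
  q = \sum_j (q.[x j] / \prod_(i < n | i != j) (x j - x i)) *:
        \prod_(i < n | i != j) ('X - (x i)%:P).
Proof.
move=> sq; apply/eqP; rewrite -subr_eq0; apply/eqP.
apply: (@roots_geq_poly_eq0 _ _ [seq x i | i <- enum 'I_n]).
- apply/allP => _ /mapP[k _ ->]; rewrite rootE hornerD hornerN horner_sum.
  rewrite (bigD1 k) //= [\sum_(i | _) _]big1 ?addr0 => [|j jk]; last first.
    rewrite hornerZ horner_prod.
    by rewrite [X in _ * X](bigD1 k) 1?eq_sym//= hornerXsubC subrr mul0r mulr0.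
  rewrite hornerZ horner_prod.
  under [X in _ * X]eq_bigr do rewrite hornerXsubC.
  rewrite divfK ?subrr//; apply/prodf_neq0 => i ik.
  by rewrite subr_eq0 inj_eq// eq_sym.
- by rewrite map_inj_uniq ?enum_uniq.
rewrite size_map size_enum_ord (leq_trans (size_polyD _ _))// geq_max sq/=.
rewrite size_polyN (leq_trans (size_sum _ _ _))//; apply/bigmax_leqP => j _.
by rewrite (leq_trans (size_scale_leq _ _))// size_prod_XsubC_neq.
Qed.

(** Compares coefficients of degree [n - 1] in the interpolation formula. *)
Lemma lagrange_lead_coef (q : {poly F}) : q \is monic -> size q = n ->
  \sum_j q.[x j] / \prod_(i < n | i != j) (x j - x i) = 1.
Proof.
move=> /monicP q1 sq; rewrite -[RHS]q1 lead_coefE sq.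
rewrite [in RHS](@lagrange_interpolation q) ?sq// coef_sum.
apply: eq_bigr => j _; rewrite coefZ.
have /monicP : \prod_(i < n | i != j) ('X - (x i)%:P) \is monic.
  exact: monic_prod_XsubC.
by rewrite lead_coefE size_prod_XsubC_neq => ->; rewrite mulr1.
Qed.

Lemma lagrange_horner (q : {poly F}) (z : F) : (size q <= n)%N ->
  q.[z] = \sum_j (q.[x j] / \prod_(i < n | i != j) (x j - x i)) *
            \prod_(i < n | i != j) (z - x i).
Proof.
move=> sq; rewrite [in LHS](lagrange_interpolation sq) horner_sum.
apply: eq_bigr => j _; rewrite hornerZ horner_prod; congr (_ * _).
by under eq_bigr do rewrite hornerXsubC.
Qed.

End Lagrange.

(** Bernoulli's inequality on each half of the exponent [u + u] yields quadratic growth. *)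
Lemma exp_dominates_linear (R : archiRealFieldType) (b C : R) : 1 < b -> 0 < C ->
  exists t : nat, C * t.+1%:R <= b ^+ t.
Proof.
move=> b1 C0; pose h := b - 1; have h0 : 0 < h by rewrite subr_gt0.
(* This [u] makes [(1 + h * u) ^+ 2] exceed [3 * C * u], which is at least [C * (2 * u + 1)]. *)
pose u := (Num.truncn (3 * C / h ^+ 2)).+1.
have Hu : 3 * C / h ^+ 2 < u%:R by rewrite truncnS_gt.
exists (u + u)%N; rewrite exprD.
have bern : 1 + h * u%:R <= b ^+ u.
  have -> : b = 1 + h by rewrite /h addrC subrK.
  elim: u {Hu} => [|u IH]; first by rewrite mulr0 addr0 expr0.
  rewrite exprS -natr1.
  have : (1 + h) * (1 + h * u%:R) <= (1 + h) * (1 + h) ^+ u.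
    by rewrite ler_pM2l//; lra.
  have : 0 <= h * h * u%:R by rewrite !mulr_ge0// ltW.
  by lra.
have u1 : 1 <= u%:R :> R by rewrite ler1n.
apply: (@le_trans _ _ ((1 + h * u%:R) * (1 + h * u%:R))); last first.
  by apply: ler_pM => //; have := mulr_ge0 (ltW h0) (ler0n R u); lra.
rewrite ltr_pdivrMr ?exprn_gt0// in Hu.
have H1 : 3 * C * u%:R <= u%:R * h ^+ 2 * u%:R by rewrite ler_pM2r ?ltW//; lra.
have H2 : C * 1 <= C * u%:R by rewrite ler_pM2l.
have H3 := mulr_ge0 (ltW h0) (ler0n R u).
by rewrite -natr1 natrD; lra.
Qed.

(** * Almost extremal points *)

Section NearFekete.
Variables (R : realType) (n : nat).
Implicit Types x : 'I_n -> R[i].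

(** Squared modulus of the Vandermonde determinant: each distance occurs in both orders, whence the
    square in [V_split]. *)
Let V x := \prod_(i < n) \prod_(k < n | k != i) normc (x i - x k).

Let V_split x j : V x = (\prod_(i < n | i != j) normc (x j - x i)) ^+ 2 *
  \prod_(i < n | i != j) \prod_(k < n | (k != i) && (k != j)) normc (x i - x k).
Proof.
rewrite /V (bigD1 j)//= expr2 -mulrA; congr (_ * _).
rewrite -big_split/=; apply: eq_bigr => i ij.
by rewrite (bigD1 j) 1?eq_sym//= normcBC.
Qed.

(* Maximizing the product of all mutual distances up to a factor 4 is enough
   here, and needs no compactness of E. *)
Lemma almost_fekete (E : set R[i]) (B : R) (e : 'I_n -> R[i]) :
  injective e -> (forall i, E (e i)) -> (forall z, E z -> normc z <= B) ->
  exists x, [/\ injective x, forall i, E (x i) &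
    forall j z, E z -> \prod_(i < n | i != j) normc (z - x i) <=
                   2 * \prod_(i < n | i != j) normc (x j - x i)].
Proof.
move=> e_inj Ee EB.
pose S := [set V x | x in [set x | forall i, E (x i)]].
have V_ge0 x : 0 <= V x.
  by apply: prodr_ge0 => i _; apply: prodr_ge0 => k _; exact: normc_ge0.
have supS : has_sup S.
  split; first by exists (V e), e.
  exists (\prod_(i < n) \prod_(k < n | k != i) (2 * B)) => _ [x Ex <-].
  apply: ler_prod => i _; rewrite prodr_ge0/= => [|k _]; last exact: normc_ge0.
  apply: ler_prod => k _; rewrite normc_ge0/=.
  apply: le_trans (le_normcD _ _) _; rewrite normcN.
  by have := EB _ (Ex i); have := EB _ (Ex k); lra.
have Ve : 0 < V e.
  apply: prodr_gt0 => i _; apply: prodr_gt0 => k ki.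
  by rewrite normc_gt0 subr_eq0 inj_eq// eq_sym.
have s0 : 0 < sup S.
  by apply: lt_le_trans Ve _; apply: sup_upper_bound => //; exists e.
(* This yields [sup S < 4 * V x], where 4 is the square of the factor 2 in the conclusion. *)
have [|_ [x Ex <-] Vx] := @sup_adherent _ S (3 / 4 * sup S) _ supS; first by lra.
have Vx4 : sup S < 4 * V x by lra.
have Vx0 : 0 < V x by lra.
exists x; split => //.
  move=> i k xik; apply/eqP; apply: contraTT (Vx0) => ik.
  rewrite -leNgt le_eqVlt; apply/orP; left; rewrite /V (bigD1 i)//=.
  by rewrite (bigD1 k) 1?eq_sym//= xik subrr normc0 !mul0r.
(* Replacing [x j] by [z] keeps the points in [E], so [V] grows by a factor less than 4. *)
move=> j z Ez; pose y i := if i == j then z else x i.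
have Vy : V y <= sup S.
  by apply: sup_upper_bound => //; exists y => //= i; rewrite /y; case: eqP.
have yj : y j = z by rewrite /y eqxx.
have yE i : i != j -> y i = x i by rewrite /y => /negbTE ->.
have {Vy} := le_lt_trans Vy Vx4; rewrite !(V_split _ j).
under eq_bigr => i ij do rewrite yj yE//.
under [X in _ * X < _]eq_bigr => i ij.
  under eq_bigr => k /andP[_ kj] do rewrite !yE//.
  over.
set P := \prod_(i < n | i != j) \prod_(k < n | _) _.
have P0 : 0 <= P.
  by apply: prodr_ge0 => i _; apply: prodr_ge0 => k _; exact: normc_ge0.
set b := \prod_(i < n | _) _; set a := \prod_(i < n | _) _ => H.
have a0 : 0 <= a by apply: prodr_ge0 => i _; exact: normc_ge0.
have b0 : 0 <= b by apply: prodr_ge0 => i _; exact: normc_ge0.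
have {}P0 : 0 < P.
  by rewrite lt_neqAle P0 andbT; apply: contraTneq H => <-; rewrite !mulr0 ltxx.
rewrite mulrA ltr_pM2r// in H.
rewrite leNgt; apply/negP => ab; suff : (2 * b) ^+ 2 <= a ^+ 2 by lra.
by rewrite lerXn2r ?nnegrE//; lra.
Qed.

End NearFekete.

Lemma sumr_const_ord (V : nmodType) (n : nat) (v : V) : v *+ n = \sum_(i < n) v.
Proof. by rewrite sumr_const card_ord. Qed.

(** * Separating two sets by a monic polynomial *)

Section Separation.
Variable R : realType.

(* With w_j the product of the |x_j - x_i|, i != j, and W the least of them,
   interpolating a power of q at the x_j bounds W from above, and interpolating
   a power of Q bounds |F| / W from below on L, where F is the monic
   polynomial with roots x_j; on E, |F| is at most 4 B W. *)
Lemma lemniscate_separation (E L : set R[i]) (B kappa delta : R)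
    (q Q : {poly R[i]}) (e : nat -> R[i]) :
  injective e -> (forall i, E (e i)) ->
  0 < B -> (forall z, E z -> normc z <= B) -> (forall z, L z -> normc z <= B) ->
  q \is monic -> (1 < size q)%N ->
  0 < kappa -> kappa < 1 -> (forall z, E z -> normc q.[z] <= kappa) ->
  0 < delta -> (forall z, E z -> normc Q.[z] <= 1) ->
  (forall z, L z -> 1 + delta <= normc Q.[z]) ->
  exists n (x : 'I_n -> R[i]) (mu : R),
    [/\ (0 < n)%N, forall i, E (x i), 0 < mu /\ mu <= 1,
        forall z, E z -> \prod_i normc (z - x i) <= mu &
        forall z, L z -> mu < \prod_i normc (z - x i)].
Proof.
move=> e_inj Ee B0 EB LB qm sq k0 k1 qE d0 QE QL.
have [l l0 Ql] := poly_lipschitz Q B.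
(* [|Q|] differs by at least [delta] between [E] and [L], so the Lipschitz bound keeps the two sets
   apart. *)
have [d dgt0 dist] : exists2 d, 0 < d & forall z w, L z -> E w -> d <= normc (z - w).
  exists (delta / l) => [|z w Lz Ew]; first by rewrite divr_gt0.
  rewrite ler_pdivrMr// mulrC.
  apply: le_trans (Ql _ _ (LB _ Lz) (EB _ Ew)).
  have := le_normcB Q.[z] Q.[w]; have := QE _ Ew; have := QL _ Lz; lra.
(* Matches degrees: with [n = (K * t).+1], [q ^+ (M * t)] has size exactly [n] and [Q ^+ t] size at
   most [n]. The successor keeps [M] positive even for constant [Q]. *)
pose M := (size Q).-1.+1; pose K := ((size q).-1 * M)%N.
have K1 : (M <= K)%N by rewrite leq_pmull// -subn1 subn_gt0.
pose b := Num.min kappa^-1 (1 + delta).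
have b1 : 1 < b by rewrite lt_min invf_gt1// k1 ltrDl.
(* The summands 1 and [2 / d] serve [Hn1] and [Hn2], which give [mu <= 1] and the bound on [L];
   [K.+1] absorbs [n <= K.+1 * t.+1]. *)
pose C := 4 * B * K.+1%:R * (1 + 2 / d).
have C0 : 0 < C by rewrite !mulr_gt0// addr_gt0// divr_gt0.
have [t Ct] := exp_dominates_linear b1 C0.
pose n := (K * t).+1.
have Hn : 4 * B * n%:R * (1 + 2 / d) <= b ^+ t.
  apply: le_trans Ct; rewrite /C -!mulrA ler_pM2l// ler_pM2l//.
  rewrite [(1 + _) * t.+1%:R]mulrC mulrA ler_pM2r ?addr_gt0 ?divr_gt0//.
  by rewrite -natrM ler_nat /n mulSn mulnS addSn ltnS addnA leq_addl.
have bt0 : 0 < b ^+ t by rewrite exprn_gt0//; lra.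
have Hn0 : 0 < 4 * B * n%:R by rewrite !mulr_gt0.
have Hd : 4 * B * n%:R * (2 / d) = (8 * B * n%:R) / d by ring.
have Hn1 : 4 * B * n%:R <= b ^+ t.
  apply: le_trans Hn; rewrite ler_peMr ?ltW//.
  by have := divr_gt0 (ltr0Sn R 1) dgt0; lra.
have Hn2 : 4 * B * n%:R < d * b ^+ t.
  have : 4 * B * n%:R * (2 / d) <= b ^+ t.
    by apply: le_trans Hn; rewrite mulrDr; lra.
  by rewrite Hd ler_pdivrMr// mulrC; lra.
have bk : b ^+ t * kappa ^+ t <= 1.
  rewrite -exprMn exprn_ile1//.
    by rewrite mulr_ge0// ltW//; lra.
  by rewrite -ler_pdivlMr// mul1r ge_min lexx.
have bd : b ^+ t <= (1 + delta) ^+ t.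
  by rewrite lerXn2r ?nnegrE ?ge_min ?lexx ?orbT//; lra.
have [||x [x_inj Ex xmax]] := @almost_fekete R n E B (fun i => e i) _ _ EB.
- by move=> i j /e_inj/val_inj.
- by move=> i; exact: Ee.
pose w j := \prod_(i < n | i != j) normc (x j - x i).
have w0 j : 0 < w j.
  by apply: prodr_gt0 => i ij; rewrite normc_gt0 subr_eq0 inj_eq// eq_sym.
have [j0 _ wmin] : exists2 j0, true & forall j, w j0 <= w j.
  by case: (@Order.TotalTheory.arg_minP _ _ _ ord0 xpredT w isT) => j0 _ H;
    exists j0 => // j; exact: H.
exists n, x, (4 * B * w j0); split => //.
- split; first by rewrite !mulr_gt0.
  (* The [n] terms of [lagrange_lead_coef] for [q'] sum to 1, and each has modulus at most
     [kappa ^+ t / w j0]. *)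
  suff H : w j0 <= n%:R * kappa ^+ t.
    apply: le_trans bk; apply: (@le_trans _ _ (4 * B * (n%:R * kappa ^+ t))).
      by rewrite ler_pM2l// mulr_gt0.
    by rewrite mulrA ler_pM2r// exprn_gt0.
  pose q' := q ^+ (M * t).
  have q'm : q' \is monic by exact: monic_exp.
  have sq' : size q' = n.
    have := size_exp q (M * t); rewrite -/q' mulnA -/K => H.
    by rewrite -(prednK (_ : 0 < size q')%N) ?H// size_poly_gt0 monic_neq0.
  have := congr1 (@normc R) (lagrange_lead_coef x_inj q'm sq').
  rewrite normc1 => H.
  have := le_normc_sum (index_enum 'I_n) xpredT
    (fun j => q'.[x j] / \prod_(i < n | i != j) (x j - x i)).
  rewrite H => {}H; rewrite -[w j0]mul1r -ler_pdivlMr//.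
  apply: le_trans H _; rewrite -mulrA mulr_natl sumr_const_ord.
  apply: ler_sum => j _; rewrite normcM normcV normc_prod -/(w j).
  apply: ler_pM; [exact: normc_ge0|by rewrite invr_ge0 ltW| |by rewrite lef_pV2 ?posrE].
  rewrite horner_exp normcX; apply: (@le_trans _ _ (kappa ^+ (M * t))).
    by rewrite lerXn2r ?nnegrE ?normc_ge0 ?qE// ltW.
  by rewrite ler_wiXn2l ?ltW// leq_pmull.
- move=> z Ez; rewrite (bigD1 j0)//=.
  have -> : 4 * B * w j0 = (2 * B) * (2 * w j0) by ring.
  apply: ler_pM; rewrite ?normc_ge0 ?xmax//.
    by apply: prodr_ge0 => i _; exact: normc_ge0.
  apply: le_trans (le_normcD _ _) _; rewrite normcN.
  by have := EB _ Ez; have := EB _ (Ex j0); lra.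
move=> z Lz; set F := \prod_i _.
have F0 : 0 <= F by apply: prodr_ge0 => i _; exact: normc_ge0.
(* In the Lagrange formula for [Q ^+ t] at [z], the product for [j] is [F] without the factor
   [|z - x j|], which is at least [d]; the values at the nodes are at most 1. *)
suff H : (1 + delta) ^+ t <= n%:R * F / (d * w j0).
  rewrite ler_pdivlMr ?mulr_gt0// in H.
  have : d * b ^+ t * w j0 <= n%:R * F.
    apply: le_trans H; rewrite [d * _]mulrC -mulrA ler_pM2r//.
    by rewrite mulr_gt0.
  have : 4 * B * n%:R * w j0 < d * b ^+ t * w j0 by rewrite ltr_pM2r.
  have -> : 4 * B * n%:R * w j0 = n%:R * (4 * B * w j0) by ring.
  by move=> lt1 le1; have := lt_le_trans lt1 le1; rewrite ltr_pM2l.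
have sQ : (size (Q ^+ t) <= n)%N.
  by apply: leq_trans (size_poly_exp_leq _ _) _; rewrite ltnS leq_mul2r ltnW ?orbT.
have Qz : (1 + delta) ^+ t <= normc (Q ^+ t).[z].
  by rewrite horner_exp normcX lerXn2r ?nnegrE ?normc_ge0 ?QL//; lra.
apply: le_trans Qz _; rewrite (lagrange_horner x_inj z sQ).
apply: le_trans (le_normc_sum _ _ _) _.
rewrite -mulrA mulr_natl sumr_const_ord.
apply: ler_sum => j _; rewrite !normcM normcV !normc_prod -/(w j).
have -> : F = normc (z - x j) * \prod_(i < n | i != j) normc (z - x i).
  by rewrite /F (bigD1 j).
set p := \prod_(i < n | _) _; have p0 : 0 <= p.
  by apply: prodr_ge0 => i _; exact: normc_ge0.
have -> : normc (z - x j) * p / (d * w j0) = (normc (z - x j) / d) * (w j0)^-1 * p.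
  by rewrite invfM; ring.
rewrite ler_wpM2r// ler_pM ?invr_ge0 ?normc_ge0 ?(ltW (w0 j))//; last first.
  by rewrite lef_pV2 ?posrE.
apply: (@le_trans _ _ 1); last by rewrite ler_pdivlMr// mul1r dist.
by rewrite horner_exp normcX exprn_ile1 ?normc_ge0 ?QE.
Qed.

End Separation.

(* Scaled Chebyshev polynomials of degree 2^j, by iterating the doubling rule
   T_2n = T_n^2 - const: they take [-a, a] to [-2 (a/2)^(2^j), 2 (a/2)^(2^j)]. *)
Lemma small_monic_poly (R : realType) (a : R) : 0 < a < 2 ->
  exists q : {poly R}, [/\ q \is monic, (1 < size q)%N &
    forall x, `|x| <= a -> `|q.[x]| <= 2 / 3].
Proof.
move=> /andP[a0 a2].
have step j : exists q : {poly R}, [/\ q \is monic, (1 < size q)%N &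
    forall x, `|x| <= a -> `|q.[x]| <= 2 * (a / 2) ^+ (2 ^ j)].
  elim: j => [|j [q [qm sq qa]]].
    exists 'X; rewrite monicX size_polyX; split=> // x xa.
    by rewrite hornerX expr1 mulrC divfK.
  pose b := 2 * (a / 2) ^+ (2 ^ j).
  have b0 : 0 <= b by rewrite mulr_ge0// exprn_ge0//; lra.
  have sq2 : (1 < size (q ^+ 2))%N.
    have := size_exp q 2; case: (size q) sq => [|[|k]]//= _.
    by case: (size _) => [|[|l]].
  have sc : (size (- (b ^+ 2 / 2)%:P : {poly R}) < size (q ^+ 2))%N.
    by rewrite size_polyN (leq_ltn_trans (size_polyC_leq1 _)).
  (* Subtracting [b ^+ 2 / 2] centres the interval from 0 to [b ^+ 2] that contains the squares. *)
  exists (q ^+ 2 - (b ^+ 2 / 2)%:P); split.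
  - by rewrite monicE lead_coefDl// -monicE monic_exp.
  - by rewrite size_polyDl.
  move=> x /qa; rewrite -/b !hornerE => qx.
  have -> : 2 * (a / 2) ^+ (2 ^ j.+1) = b ^+ 2 / 2.
    by rewrite /b expnSr exprM; field.
  have : q.[x] ^+ 2 <= b ^+ 2.
    by rewrite -real_normK ?num_real// lerXn2r ?nnegrE.
  have := sqr_ge0 q.[x]; rewrite ler_norml => H1 H2; apply/andP; split; lra.
have inv1 : 1 < (a / 2)^-1 by rewrite invf_gt1; lra.
(* The constant 3 gives [(a / 2) ^+ t <= 1 / 3], and [2 ^ t] exceeds [t]. *)
have [|t Ht] := @exp_dominates_linear R _ 3 inv1; first by lra.
have [q [qm sq qa]] := step t; exists q; split => // x /qa qx.
apply: le_trans qx _; rewrite ler_pM2l//.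
have r0 : 0 < (a / 2) ^+ t by rewrite exprn_gt0//; lra.
apply: (@le_trans _ _ ((a / 2) ^+ t)).
  by rewrite ler_wiXn2l ?(ltnW (ltn_expl _ _))//; lra.
rewrite exprVn in Ht.
have t1 : 1 <= t.+1%:R :> R by rewrite ler1n.
have : 3 <= ((a / 2) ^+ t)^-1 by lra.
by rewrite -[leRHS]mul1r ler_pdivlMr//; lra.
Qed.

(** * Points of the unit circle *)

Section Cis.
Variable R : realType.
Implicit Types t s : R.

Definition cis t : R[i] := cos t +i* sin t.

Lemma cisD t s : cis (t + s) = cis t * cis s.
Proof. by rewrite /cis cosD sinD; congr (_ +i* _); rewrite addrC. Qed.

Lemma cis0 : cis 0 = 1.
Proof. by rewrite /cis cos0 sin0. Qed.

Lemma cisX t n : cis t ^+ n = cis (n%:R * t).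
Proof.
elim: n => [|n IH]; first by rewrite mul0r cis0.
by rewrite exprS IH -cisD -natr1 mulrDl mul1r addrC.
Qed.

Lemma normc_cis t : normc (cis t) = 1.
Proof. by rewrite /= cos2Dsin2 sqrtr1. Qed.

Lemma cis_natpi n : cis (n%:R * pi) = (-1) ^+ n.
Proof.
by rewrite -cisX /cis cospi sinpi -[-1 +i* 0]/((-1)%:C) rmorphN rmorph1.
Qed.

(** Continuity of [cos] at 0, since [|cis t - 1| ^+ 2 = 2 - 2 * cos t]. *)
Lemma cis_near1 (eps : R) : 0 < eps ->
  exists2 eta : R, 0 < eta & forall t, `|t| < eta -> normc (cis t - 1) <= eps.
Proof.
move=> e0.
have /cvgrPdist_lt/(_ (eps ^+ 2 / 2)) : cos x @[x --> (0 : R)] --> cos (0 : R).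
  exact: continuous_cos.
rewrite cos0 => /(_ _)[|eta /= eta0 H]; first by rewrite divr_gt0 ?exprn_gt0.
exists eta => // t teta; have {H} := H t.
rewrite /ball_/= sub0r normrN => /(_ teta) H.
have {}H := le_lt_trans (ler_norm _) H.
have -> : eps = Num.sqrt (eps ^+ 2) by rewrite sqrtr_sqr ger0_norm ?ltW.
rewrite /= subr0; apply: ler_wsqrtr.
have := cos2Dsin2 t; lra.
Qed.

Lemma Im_mul_cis (r t s : R) : complex.Im (r%:C * cis t * cis (- s)) = r * sin (t - s).
Proof. by rewrite -mulrA -cisD /= mul0r addr0. Qed.

Lemma Im_cis_eq0 (z : R[i]) t : complex.Im (z * cis (- t)) = 0 ->
  z = (complex.Re (z * cis (- t)))%:C * cis t.
Proof.
move=> H; rewrite -{1}(mulr1 z) -cis0 -(addNr t) cisD mulrA; congr (_ * _).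
by move: H; case: (_ * _) => u v /= ->.
Qed.

End Cis.

(** * Connected sets in the complex plane *)

Section Topology.
Variable R : realType.

Lemma continuous_Im_mul (u : R[i]) :
  continuous ((fun z => complex.Im (z * u)) : R[i]^o -> R).
Proof.
move=> z.
apply/(@cvgrPdist_lt R R R[i]^o (nbhs (z : R[i]^o)) (nbhs_filter _)) => e e0.
apply/(@nbhs_ballP R[i] R[i]^o).
exists (e / (normc u + 1))%:C => /=.
  by rewrite ltcR divr_gt0// ltr_wpDl ?normc_ge0.
move=> w; rewrite /ball/= normc_normr ltcR => H.
have -> : complex.Im (z * u) - complex.Im (w * u) = complex.Im ((z - w) * u).
  by rewrite mulrBl; case: (z * u) (w * u) => [? ?] [? ?].
have : `|complex.Im ((z - w) * u)| <= normc ((z - w) * u).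
  case: (_ * _) => x y /=; rewrite -[leLHS]sqrtr_sqr.
  by apply: ler_wsqrtr; rewrite lerDr sqr_ge0.
rewrite normcM => /le_lt_trans; apply.
rewrite ltr_pdivlMr ?ltr_wpDl ?normc_ge0// in H.
apply: le_lt_trans H; rewrite ler_wpM2l ?normc_ge0//; lra.
Qed.

Lemma continuous_real_mul (u : R[i]) :
  continuous ((fun t => t%:C * u) : R -> R[i]^o).
Proof.
move=> t; apply/cvgrPdist_lt => -[e e']; rewrite ltcE/= => /andP[/eqP-> e0].
apply/nbhs_ballP; exists (e / (normc u + 1)) => /=.
  by rewrite divr_gt0// ltr_wpDl ?normc_ge0.
move=> s; rewrite /ball/= => H.
rewrite normc_normr -mulrBl -rmorphB normcM normcR ltcR.
rewrite ltr_pdivlMr ?ltr_wpDl ?normc_ge0// in H.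
apply: le_lt_trans H; rewrite ler_wpM2l//; lra.
Qed.

(** Intermediate values: the image of [K] under [Im (z * u)] is connected, hence an interval. *)
Lemma connected_Im_separated (K : set R[i]^o) (u z w : R[i]) :
  connected K -> K z -> K w ->
  complex.Im (z * u) <= 0 <= complex.Im (w * u) ->
  exists2 y, K y & complex.Im (y * u) = 0.
Proof.
move=> cK Kz Kw zw; pose f := (fun z => complex.Im (z * u)) : R[i]^o -> R.
have : connected (f @` K).
  apply: connected_continuous_connected => //.
  exact/continuous_subspaceT/continuous_Im_mul.
move/connected_intervalP => /(_ (f z) (f w)); case/(_ _ _ 0 zw).
- by exists z.
- by exists w.
by move=> y Ky y0; exists y.
Qed.

Lemma connected_radial_segment (u : R[i]) (a b : R) :
  connected ([set t%:C * u | t in `[a, b]] : set R[i]^o).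
Proof.
apply: (@connected_continuous_connected R R[i]^o); first exact: segment_connected.
exact/continuous_subspaceT/continuous_real_mul.
Qed.

End Topology.

(** * Arcs on rays and the lines between them *)

Definition ray_angle (R : realType) (m j : nat) : R := j%:R * pi / m%:R.

Lemma prodr_gt1 (R : realDomainType) (n : nat) (F : 'I_n -> R) :
  (0 < n)%N -> (forall i, 1 < F i) -> 1 < \prod_i F i.
Proof.
case: n F => // n F _ F1; rewrite big_ord_recl.
have : 1 <= \prod_(i < n) F (lift ord0 i).
  rewrite -[leLHS](expr1n _ n) -[n in _ ^+ n]card_ord -prodr_const.
  by apply: ler_prod => i _; rewrite ler01 ltW.
by move=> H; apply: (lt_le_trans (F1 ord0)); rewrite ler_peMr// ltW// (lt_trans _ (F1 _)).
Qed.

Lemma ray_angleX (R : realType) (m j : nat) (s : R) : (0 < m)%N ->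
  (s%:C * cis (ray_angle R m j)) ^+ m = (s ^+ m * (-1) ^+ j)%:C.
Proof.
move=> m0; rewrite exprMn cisX /ray_angle mulrCA mulfV ?pnatr_eq0 -?lt0n//.
by rewrite mulr1 cis_natpi rmorphM !rmorphXn rmorphN rmorph1.
Qed.

(* The arcs lie on the rays of even index, close to [4 - a, 4 + a]; the
   separating lines carry the rays of odd index. On these z^m is real,
   positive on the arcs and negative on the separating half-lines, so
   1 - z^m / (4 + a)^m has modulus at most 1 on the former, more on the
   latter. *)
Lemma separated_arcs (R : realType) (a : R) (N : nat) : 0 < a < 2 ->
  exists m n (x : 'I_n -> R[i]) (mu : R),
  [/\ (0 < n)%N /\ (4 * N.+1 <= m)%N, 0 < mu /\ mu <= 1,
      forall k s, (k <= N)%N -> 4 - a <= s <= 4 + a ->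
        \prod_i normc (s%:C * cis (ray_angle R m k.*2) - x i) <= mu &
      forall k s, (k <= N)%N ->
        mu < \prod_i normc (s%:C * cis (ray_angle R m k.*2.+1) - x i)].
Proof.
move=> a02; have [q [qm sq qa]] := small_monic_poly a02.
case/andP: a02 => a0 a2.
have C8 (s t : R) : `|s| <= 8 -> normc (s%:C * cis t) <= 8.
  by rewrite normcM normc_cis normcR mulr1.
pose p := map_poly (real_complex R) q \Po ('X - 4%:P).
have sX : size ('X - 4%:P : {poly R[i]}) = 2 by rewrite size_XsubC.
have sp : size p = size q by rewrite size_comp_poly2// size_map_poly.
have pm : p \is monic.
  rewrite monicE lead_coef_comp ?sX// lead_coefXsubC expr1n mulr1.
  by rewrite lead_coef_map (monicP qm) rmorph1.
have pE s : 4 - a <= s <= 4 + a -> normc p.[s%:C] <= 2 / 3.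
  move=> sa; rewrite horner_comp hornerXsubC.
  have -> : s%:C - 4 = (s - 4)%:C by rewrite rmorphB rmorph_nat.
  by rewrite horner_map normcR qa// ler_norml; lra.
have [l l0 pl] := poly_lipschitz p 8.
(* Arcs have [|s| <= 6], so rotating [s] onto one changes [p] by at most
   [l * 6 / (72 * l) = 1 / 12], and [2 / 3 + 1 / 12 = 3 / 4]. *)
have [|eta eta0 Heta] := @cis_near1 R (1 / (72 * l)).
  by rewrite divr_gt0// mulr_gt0.
(* The first summand brings the arcs within angle [eta] of the real axis; the second keeps all rays
   used within a right angle of each other. *)
have [m [m0 Nm meta]] : exists m : nat,
    [/\ (0 < m)%N, (4 * N.+1 <= m)%N & N.*2%:R * pi / eta < m%:R].
  exists ((Num.truncn (N.*2%:R * pi / eta)).+1 + 4 * N.+1)%N.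
  split; rewrite ?leq_addl//.
  by apply: (lt_le_trans (truncnS_gt _)); rewrite ler_nat leq_addr.
have mR : 0 < m%:R :> R by rewrite ltr0n.
have angle_eta k : (k <= N)%N -> `|ray_angle R m k.*2| < eta.
  move=> kN; rewrite ger0_norm ?divr_ge0 ?mulr_ge0 ?pi_ge0//.
  rewrite ltr_pdivrMr// [ltRHS]mulrC -ltr_pdivrMr//; apply: le_lt_trans meta.
  by rewrite ler_pM2r ?invr_gt0// ler_pM2r ?pi_gt0// ler_nat leq_double.
pose E : set R[i] := [set z | exists k s, [/\ (k <= N)%N, 4 - a <= s <= 4 + a &
  z = s%:C * cis (ray_angle R m k.*2)]].
pose L : set R[i] := [set z | exists k s, [/\ (k <= N)%N, 1 <= s <= 7 &
  z = s%:C * cis (ray_angle R m k.*2.+1)]].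
pose M := (4 + a) ^+ m; have M0 : 0 < M by rewrite exprn_gt0//; lra.
pose Q : {poly R[i]} := 1 - (M^-1)%:C *: 'X^m.
have QE j s : Q.[s%:C * cis (ray_angle R m j)] = (1 - s ^+ m * (-1) ^+ j / M)%:C.
  rewrite !hornerE ray_angleX//.
  by rewrite rmorphB rmorph1 -rmorphM mulrC.
(* Infinitely many distinct points of the arc on the real axis. *)
pose e (i : nat) := (4 + a / i.+1%:R)%:C * cis (ray_angle R m 0).
(* On [L], [s >= 1] gives [s ^+ m / M >= M^-1], hence [delta = M^-1]. *)
have [|||||||||||||n [x [mu [n0 Ex mu1 HE HL]]]] :=
  @lemniscate_separation R E L 8 (3 / 4) M^-1 p Q e; rewrite ?sp ?invr_gt0//.
- move=> i j; rewrite /e /ray_angle mul0r mul0r cis0 !mulr1 => -[/addrI].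
  move=> /(mulfI (lt0r_neq0 a0))/invr_inj/eqP.
  by rewrite eqr_nat => /eqP[].
- move=> i; exists 0%N, (4 + a / i.+1%:R); split => //.
  have : a / i.+1%:R <= a by rewrite ler_pdivrMr// ler_peMr ?(ltW a0)// ler1n.
  have : 0 <= a / i.+1%:R by rewrite divr_ge0 ?(ltW a0).
  by set v := a / _ => v0 va; apply/andP; split; lra.
- by move=> _ [k [s [_ s4 ->]]]; apply: C8; rewrite ler_norml; lra.
- by move=> _ [k [s [_ s4 ->]]]; apply: C8; rewrite ler_norml; lra.
- by lra.
- move=> _ [k [s [kN s4 ->]]]; set z := s%:C * _.
  rewrite -(subrK p.[s%:C] p.[z]); apply: le_trans (le_normcD _ _) _.
  have s8 : `|s| <= 8 by rewrite ler_norml; lra.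
  have := pl z s%:C (C8 _ _ s8); rewrite normcR => /(_ s8).
  have -> : z - s%:C = s%:C * (cis (ray_angle R m k.*2) - 1) by rewrite /z; ring.
  rewrite normcM normcR => H.
  have := Heta _ (angle_eta _ kN); set c := normc _ => cl.
  have c0 : 0 <= c by exact: normc_ge0.
  have : l * (`|s| * c) <= l * (6 * (1 / (72 * l))).
    rewrite ler_pM2l// ler_pM// ler_norml; lra.
  have -> : l * (6 * (1 / (72 * l))) = 1 / 12 by field; rewrite gt_eqF.
  by move=> lsc; have := le_trans H lsc; have := pE _ s4; lra.
- move=> _ [k [s [kN s4 ->]]]; rewrite QE normcR -mul2n exprM sqrrN !expr1n mulr1.
  have : 0 <= s ^+ m / M by rewrite divr_ge0 ?(ltW M0)// exprn_ge0//; lra.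
  have : s ^+ m / M <= 1.
    by rewrite ler_pdivrMr// mul1r lerXn2r ?nnegrE//; lra.
  by rewrite ler_norml; lra.
- move=> _ [k [s [kN s4 ->]]].
  rewrite QE normcR exprS -mul2n exprM sqrrN !expr1n !mulr1 mulrN1 mulNr opprK.
  apply: le_trans (ler_norm _); rewrite lerD2l -[leLHS]mul1r ler_pM2r ?invr_gt0//.
  by rewrite exprn_ege1//; lra.
exists m, n, x, mu; split => //.
  by move=> k s kN s4; apply: HE; exists k, s.
(* Outside [[1, 7]] every factor exceeds 1, as the roots have modulus [r] with [2 < r < 6]: by the
   difference of moduli if [s > -1], otherwise by the real part after a rotation. *)
move=> k s kN; have [s17|] := boolP (1 <= s <= 7); first by apply: HL; exists k, s.
rewrite negb_and -!ltNge => s17; apply: le_lt_trans (proj2 mu1) _.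
apply: prodr_gt1 => // i; have [j [r [jN r4 ->]]] := Ex i.
have r0 : `|r| = r by rewrite ger0_norm; lra.
have [s1|s1] := leP s (-1); last first.
  have H := le_normcB; case/orP: s17 => s17.
    apply: lt_le_trans (_ : normc (r%:C * cis (ray_angle R m j.*2)) -
      normc (s%:C * cis (ray_angle R m k.*2.+1)) <= _); last first.
      by rewrite [leRHS]normcBC.
    have : `|s| < 1 by rewrite ltr_norml s17 s1.
    by rewrite !normcM !normc_cis !normcR; lra.
  apply: lt_le_trans (H _ _ _).
  have : s <= `|s| by exact: ler_norm.
  by rewrite !normcM !normc_cis !normcR; lra.
pose t := ray_angle R m k.*2.+1 - ray_angle R m j.*2.
have -> : s%:C * cis (ray_angle R m k.*2.+1) - r%:C * cis (ray_angle R m j.*2) =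
  (s%:C * cis t - r%:C) * cis (ray_angle R m j.*2).
  by rewrite mulrBl -mulrA -cisD /t subrK.
rewrite normcM normc_cis mulr1; apply: lt_le_trans (le_Re_normc _).
(* The two ray indices differ by at most [2 * N + 1], which is below [m / 2]. *)
have t0 : 0 <= cos t.
  have pim : 0 < pi / m%:R :> R by rewrite divr_gt0// pi_gt0.
  have -> : t = (k.*2.+1%:R - j.*2%:R) * (pi / m%:R).
    by rewrite /t /ray_angle; ring.
  have pm2 : pi / 2 = m%:R / 2 * (pi / m%:R) :> R by field; rewrite gt_eqF.
  apply: cos_ge0_pihalf; rewrite pm2 -mulNr !ler_pM2r//.
  have dbl h : h.*2%:R = 2 * h%:R :> R by rewrite -mul2n natrM.
  have kR : k%:R <= N%:R :> R by rewrite ler_nat.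
  have jR : j%:R <= N%:R :> R by rewrite ler_nat.
  have : (4 * N.+1)%:R <= m%:R :> R by rewrite ler_nat.
  rewrite natrM -(@natr1 R N) -(@natr1 R k.*2) !dbl.
  by have := ler0n R k; have := ler0n R j; lra.
have -> : complex.Re (s%:C * cis t - r%:C) = s * cos t - r.
  by rewrite /= mul0r subr0.
have : s * cos t <= 0 by rewrite mulr_le0_ge0//; lra.
by move=> sc; rewrite ltr0_norm; lra.
Qed.

(** * Rescaling and distinct components *)

Lemma root_rescaling (R : realType) (mu : R) (n : nat) : (0 < n)%N ->
  0 < mu <= 1 -> exists2 lam : R, 1 <= lam & lam ^+ n * mu = 1.
Proof.
move=> n0 /andP[mu0 mu1]; exists (mu^-1 `^ n%:R^-1).
  have := @ler_powR R mu^-1; rewrite invf_ge1// => /(_ mu1 0 n%:R^-1).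
  by rewrite powRr0 invr_ge0; apply.
rewrite -powR_mulrn ?powR_ge0// -powRrM mulVf ?pnatr_eq0 -?lt0n//.
by rewrite powRr1 ?invr_ge0 ?(ltW mu0)// mulVf// gt_eqF.
Qed.

Theorem mainTheorem1 (R : realType) (c : R) (N : nat) (hc : 0 < c < 4) :
  exists2 p : {poly R[i]}, p \is monic &
    `I_N #<= [set K | components (lemniscate_set p) K
                      /\ (c%:E <= diameter K)%E].
Proof.
have [|m [n [x [mu [[n0 Nm] mu01 HE HL]]]]] := @separated_arcs R (c / 2) N.
  by lra.
have [|lam lam1 lamE] := @root_rescaling R mu n n0; first by apply/andP.
have lam0 : 0 < lam by lra.
(* Scaling the roots by [lam] turns the level [mu] into the level 1. *)
pose p := \prod_(i < n) ('X - (lam%:C * x i)%:P).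
have pE z : normc p.[lam%:C * z] = lam ^+ n * \prod_i normc (z - x i).
  rewrite horner_prod normc_prod -[n in _ ^+ n]card_ord -prodr_const -big_split/=.
  apply: eq_bigr => i _.
  by rewrite hornerXsubC -mulrBr normcM normcR ger0_norm// ltW.
have lamn : 0 < lam ^+ n by rewrite exprn_gt0.
have lem_p z : lemniscate_set p z <-> normc p.[z] <= 1.
  by rewrite /lemniscate_set/= normc_normr -(lecR (normc _)).
exists p; first exact: monic_prod_XsubC.
(* As [ray k] includes [lam], the segments [S k] have length [c * lam >= c]. *)
pose ray k := lam%:C * cis (ray_angle R m k.*2).
pose S k : set R[i]^o := [set t%:C * ray k | t in `[4 - c / 2, 4 + c / 2]].
have S_sub k : (k <= N)%N -> S k `<=` lemniscate_set p.
  move=> kN _ [t /= t4 <-]; apply/lem_p.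
  have -> : t%:C * ray k = lam%:C * (t%:C * cis (ray_angle R m k.*2)).
    by rewrite /ray mulrCA.
  by rewrite pE -[leRHS]lamE ler_pM2l//; apply: HE; rewrite in_itv in t4.
pose pt k t : R[i]^o := t%:C * ray k.
have S_l k : S k (pt k (4 - c / 2)) by exists (4 - c / 2); rewrite //= in_itv/=; lra.
have S_r k : S k (pt k (4 + c / 2)) by exists (4 + c / 2); rewrite //= in_itv/=; lra.
pose comp k := connected_component (lemniscate_set p) (pt k (4 - c / 2)).
have S_comp k : (k <= N)%N -> S k `<=` comp k.
  by move=> kN; apply: connected_component_max => //;
    [exact: S_sub|exact: connected_radial_segment].
(* The line of index [k.*2.+1] separates the rays [k.*2] and [l.*2]: seen from it, their angles are
   [- pi / m] and one in [[0, pi]], so the sines have opposite signs. *)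
have comp_neq k l : (k < l)%N -> (l <= N)%N -> comp k <> comp l.
  move=> kl lN kl_eq; have kN : (k <= N)%N by rewrite (leq_trans (ltnW kl)).
  have ptl : comp k (pt l (4 - c / 2)) by rewrite kl_eq; exact: S_comp.
  have ptk : comp k (pt k (4 - c / 2)) by exact: S_comp.
  have ImE j : complex.Im (pt j (4 - c / 2) * cis (- ray_angle R m k.*2.+1)) =
      (4 - c / 2) * lam * sin (ray_angle R m j.*2 - ray_angle R m k.*2.+1).
    by rewrite /pt /ray mulrA -rmorphM Im_mul_cis.
  have mR : 0 < m%:R :> R by rewrite ltr0n (leq_trans _ Nm).
  have pim : 0 < pi / m%:R :> R by rewrite divr_gt0// pi_gt0.
  have angE i j : ray_angle R m i - ray_angle R m j = (i%:R - j%:R) * (pi / m%:R).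
    by rewrite /ray_angle; ring.
  have piE : pi = m%:R * (pi / m%:R) :> R by field; rewrite gt_eqF.
  have [||y Ky] := @connected_Im_separated R (comp k) (cis (- ray_angle R m k.*2.+1))
    _ _ _ ptk ptl; first exact: component_connected.
    have c4 : 0 <= (4 - c / 2) * lam by rewrite mulr_ge0//; lra.
    rewrite !ImE; apply/andP; split.
      rewrite mulr_ge0_le0// angE -natr1 opprD addrA subrr sub0r mulN1r sinN oppr_le0.
      rewrite sin_ge0_pi// (ltW pim)/= [leRHS]piE ler_peMl ?(ltW pim)//.
      by rewrite ler1n (leq_trans _ Nm).
    rewrite mulr_ge0// angE sin_ge0_pi// [X in _ && (_ <= X)]piE ler_pM2r// pmulr_lge0//.
    rewrite subr_ge0 ler_nat ltn_double kl/= lerBlDr -natrD ler_nat.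
    apply: (leq_trans _ (leq_addr _ _)); apply: leq_trans Nm; lia.
  (* The component would meet the line at [y] with [|p.[y]| <= 1], against [HL], which holds for [s]
     of either sign. *)
  move=> /Im_cis_eq0 yE.
  have /lem_p : lemniscate_set p y by exact: (connected_component_sub Ky).
  set r := complex.Re _ in yE.
  have {}yE : y = lam%:C * ((r / lam)%:C * cis (ray_angle R m k.*2.+1)).
    by rewrite mulrA -rmorphM [lam * _]mulrC divfK ?gt_eqF.
  by rewrite yE pE -[leRHS]lamE ler_pM2l// leNgt HL.
have comp_inj : {in `I_N &, injective comp}.
  move=> k l /set_mem/= kN /set_mem/= lN; case: (ltngtP k l) => // kl.
    by move/(comp_neq _ _ kl (ltnW lN)).
  by move/esym/(comp_neq _ _ kl (ltnW kN)).
rewrite -(card_le_eql (inj_card_eq comp_inj)).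
apply: subset_card_le => _ [k /= kN <-]; split.
  by exists (pt k (4 - c / 2)) => //; apply: S_sub (S_l k); exact: ltnW.
apply: (@le_trans _ _ (complex.Re `|pt k (4 + c / 2) - pt k (4 - c / 2)|)%:E).
  have -> : pt k (4 + c / 2) - pt k (4 - c / 2) = c%:C * ray k.
    by rewrite /pt -mulrBl -rmorphB; congr (_%:C * _); lra.
  rewrite lee_fin normc_normr -[complex.Re _]/(normc _) !normcM normc_cis !normcR mulr1.
  by rewrite !ger0_norm; nra.
apply: ereal_sup_ubound; exists (pt k (4 + c / 2)).
  exact: (S_comp _ (ltnW kN) _ (S_r k)).
by exists (pt k (4 - c / 2)) => //; exact: (S_comp _ (ltnW kN) _ (S_l k)).
Qed.
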